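(* Let $G$ be a connected, undirected weighted graph with $n$ nodes and graph Laplacian $L$, let $\tau>0$ and $A_G=e^{-\tau L}$. Let $s_1\le s_2\le\dots\le s_{\min\{n,m\}}$ be the eigenvalues of $L$ (here $m=n$). Then $$\triangle_2(A_G)\le\sum_{k=2}^{\min\{n,m\}}e^{-\tau s_k}\,\big|(U_i)_k-(U_j)_k\big| ,$$ where $U_i$ is the $i$th row of the matrix whose columns are the left singular vectors of $L$ (the $k$th column corresponding to $s_k$), $(U_i)_k$ is its $k$th entry, and $i,j$ is the pair of neighbouring nodes at which the maximum defining $\triangle_2(A_G)$ is attained.
   Context: $W$ is the symmetric $n\times n$ matrix of edge weights of $G$, $D$ is the diagonal matrix with $D_{ii}$ the sum of the $i$th row of $W$, and $L=D-W$. The parameter $\tau$ controls the rate of diffusion. The nodes of $G$ are the source locations, with metric the shortest-path distance between nodes; neighbours are neighbouring nodes of $G$. The matrix $A_G$ is $n\times n$, so the number $m$ of measurements equals $n$. For an $m\times n$ matrix $M$ with columns $M_1,\dots,M_n$ and a parameter $\alpha>0$ (two source vectors being called $\alpha$-neighbours when their Earth Mover Distance is at most $\alpha$), $$\triangle_2(M)=\alpha\max_{i,j\ \text{neighbours}}\|M_i-M_j\|_2 .$$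
   Formalization: The right-hand side is multiplied by the factor α from the definition of △₂; without it the inequality fails for α > 1 (e.g. two nodes joined by one edge, where it is an equality at α = 1), while for α ≤ 1 the printed bound follows. *)

(* Defs.v *)
From HB Require Import structures.
From mathcomp Require Export all_boot all_order all_algebra.
From mathcomp Require Export all_classical all_reals all_analysis.
Set Implicit Arguments.
Unset Strict Implicit.
Unset Printing Implicit Defensive.
Export Order.TTheory GRing.Theory Num.Theory numFieldNormedType.Exports.
Local Open Scope ring_scope.

(* A weighted graph on the nodes 'I_n is given by its symmetric matrix of
   nonnegative edge weights, a zero weight meaning that there is no edge.
   Self-loops are harmless: they cancel in the Laplacian. *)
Definition edge_weights (R : realType) (n : nat) (W : 'M[R]_n) : Prop :=
  W^T = W /\ forall i j, 0 <= W i j.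

Definition neighbours (R : realType) (n : nat) (W : 'M[R]_n) : rel 'I_n :=
  fun i j => (i != j) && (0 < W i j).

Definition connected_graph (R : realType) (n : nat) (W : 'M[R]_n) : Prop :=
  forall i j, connect (neighbours W) i j.

Definition laplacian (R : realType) (n : nat) (W : 'M[R]_n) : 'M[R]_n :=
  diag_mx (\row_i \sum_j W i j) - W.

(* The limit is taken in the normed space of n x n matrices. *)
Definition expmx (R : realType) (n : nat) (X : 'M[R]_n) : 'M[R]_n :=
  limn (series (fun k : nat => (k`!%:R : R)^-1 *: X ^+ k)).

(* The norm `|v| of the library is the sup norm. *)
Definition norm2 (R : realType) (m : nat) (v : 'cV[R]_m) : R :=
  Num.sqrt (\sum_i v i ord0 ^+ 2).

(* The maximum over an empty set of pairs is 0. *)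
Definition Delta2 (R : realType) (alpha : R) (m n : nat) (nb : rel 'I_n)
    (M : 'M[R]_(m, n)) : R :=
  alpha * \big[Num.max/0]_(p : 'I_n * 'I_n | nb p.1 p.2)
            norm2 (col p.1 M - col p.2 M).

Definition attains_Delta2 (R : realType) (alpha : R) (m n : nat)
    (nb : rel 'I_n) (M : 'M[R]_(m, n)) (i j : 'I_n) : Prop :=
  nb i j /\ Delta2 alpha nb M = alpha * norm2 (col i M - col j M).

(* s lists the eigenvalues with (algebraic) multiplicity. *)
Definition sorted_eigenvalues (R : realType) (n : nat) (M : 'M[R]_n)
    (s : 'rV[R]_n) : Prop :=
  char_poly M = \prod_(k < n) ('X - (s ord0 k)%:P) /\
  forall k l : 'I_n, (k <= l)%N -> s ord0 k <= s ord0 l.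

(* U is the left factor of a singular value decomposition M = U diag(s) V^T. *)
Definition left_singular_vectors (R : realType) (n : nat) (M : 'M[R]_n)
    (s : 'rV[R]_n) (U : 'M[R]_n) : Prop :=
  (forall k, 0 <= s ord0 k) /\
  exists V : 'M[R]_n,
    [/\ U^T *m U = 1%:M, V^T *m V = 1%:M & M = U *m diag_mx s *m V^T].

(* Main.v *)
(* The left singular vectors of L form an orthonormal eigenbasis, so
   A_G = U diag(exp(-tau s)) U^T and the difference of columns i and j of A_G is
   U v with v_k = exp(-tau s_k) (U_ik - U_jk).  Hence its 2-norm is that of v,
   which is at most the 1-norm of v.  The smallest eigenvalue is 0, and a vector
   of the kernel of L takes equal values at neighbours, so v_1 = 0. *)
Require Import Defs.
From mathcomp Require Import ring.
Set Implicit Arguments.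
Unset Strict Implicit.
Local Open Scope ring_scope.

Lemma cvg_sum_fun (R : realType) (V : normedModType R) (I : Type) (r : seq I)
    (f : I -> nat -> V) (l : I -> V) :
  (forall i, (f i N @[N --> \oo] --> l i)%classic) ->
  (\sum_(i <- r) f i N @[N --> \oo] --> \sum_(i <- r) l i)%classic.
Proof.
move=> fl; apply: cvg_big => //; exact: add_continuous.
Qed.

Lemma mulmx_diag_sum (R : comPzRingType) (m n p : nat) (A : 'M[R]_(m, n))
    (d : 'rV[R]_n) (B : 'M[R]_(n, p)) :
  A *m diag_mx d *m B = \sum_k d 0 k *: (col k A *m row k B).
Proof.
rewrite mul_mx_diag; apply/matrixP=> i j; rewrite summxE mxE.
by apply: eq_bigr => k _; rewrite !mxE big_ord1 !mxE mulrCA mulrA.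
Qed.

Section OrthogonalDiagonalization.
Variables (R : realType) (n : nat) (U : 'M[R]_n).
Hypothesis U_orth : U^T *m U = 1%:M.

Lemma exp_mx_orthogonal_diag (d : 'rV[R]_n) (k : nat) :
  (U *m diag_mx d *m U^T) ^+ k = U *m diag_mx (\row_l d 0 l ^+ k) *m U^T.
Proof.
elim: k => [|k IHk].
  have -> : \row_l d 0 l ^+ 0 = const_mx 1 by apply/rowP=> l; rewrite !mxE.
  (* Exponent 0 needs [U *m U^T = 1], which follows from [U^T *m U = 1] because [U] is square. *)
  by rewrite diag_const_mx mulmx1 (mulmx1C U_orth).
rewrite exprS IHk -mulmxE !mulmxA -[U *m _ *m _ *m U]mulmxA U_orth mulmx1.
rewrite -(mulmxA U) mulmx_diag; congr (_ *m diag_mx _ *m _).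
by apply/rowP=> l; rewrite !mxE exprS.
Qed.

(** Each partial sum is a combination of the fixed rank-one matrices [col k U *m row k U^T], with
    partial sums of the scalar exponential series at [d 0 k] as coefficients; so the matrix limit
    reduces to finitely many scalar ones. *)
Lemma expmx_orthogonal_diag (d : 'rV[R]_n) :
  expmx (U *m diag_mx d *m U^T) = U *m diag_mx (\row_k expR (d 0 k)) *m U^T.
Proof.
rewrite /expmx.
have -> : series (fun k => (k`!%:R : R)^-1 *: (U *m diag_mx d *m U^T) ^+ k)
  = (fun N => \sum_k series (exp_coeff (d 0 k)) N *: (col k U *m row k U^T)).
  apply/funext=> N; rewrite /series /=.
  under eq_bigr do rewrite exp_mx_orthogonal_diag mulmx_diag_sum scaler_sumr.
  rewrite exchange_big; apply: eq_bigr => k _; rewrite scaler_suml.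
  by apply: eq_bigr => l _; rewrite scalerA mxE exp_coeffE mulrC.
apply: cvg_lim; first exact: norm_hausdorff.
rewrite mulmx_diag_sum; apply: cvg_sum_fun => k; rewrite mxE; apply: cvgZr_tmp.
exact: is_cvg_series_exp_coeff.
Qed.

Lemma norm2_orthogonal (v : 'cV[R]_n) : norm2 (U *m v) = norm2 v.
Proof.
have sumE (w : 'cV[R]_n) : \sum_i w i 0 ^+ 2 = (w^T *m w) 0 0.
  by rewrite mxE; apply: eq_bigr => i _; rewrite mxE.
by rewrite /norm2 !sumE trmx_mul mulmxA -(mulmxA v^T) U_orth mulmx1.
Qed.

End OrthogonalDiagonalization.

(** Squares are compared: each [|v_i|^2] is at most [|v_i|] times the whole 1-norm. *)
Lemma norm2_le_sum (R : realType) (n : nat) (v : 'cV[R]_n) :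
  norm2 v <= \sum_i `|v i 0|.
Proof.
have S0 : 0 <= \sum_i `|v i 0| by exact: sumr_ge0.
rewrite /norm2 -(ger0_norm S0) -sqrtr_sqr ler_wsqrtr// expr2 mulr_sumr.
apply: ler_sum => i _; rewrite -real_normK ?num_real// expr2 ler_wpM2r//.
by rewrite (bigD1 i)//= lerDl sumr_ge0.
Qed.

Lemma trmx_mul_eq0 (R : realType) (n : nat) (v : 'cV[R]_n) :
  v^T *m v = 0 -> v = 0.
Proof.
move=> /matrixP/(_ 0 0); rewrite !mxE => v0.
apply/colP=> i; rewrite mxE; apply/eqP; rewrite -sqrf_eq0 expr2.
have /psumr_eq0P := v0 => /(_ _ i isT); rewrite !mxE => -> // k _.
by rewrite mxE -expr2 sqr_ge0.
Qed.

Lemma sorted_eigenvalues_eigenvalue (R : realType) (n : nat) (M : 'M[R]_n)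
    (s : 'rV[R]_n) (a : R) :
  sorted_eigenvalues M s -> eigenvalue M a -> exists k, s 0 k = a.
Proof.
move=> [charM _]; rewrite eigenvalue_root_char charM /root horner_prod.
move=> /prodf_eq0[k _]; rewrite hornerXsubC subr_eq0 => /eqP ->.
by exists k.
Qed.

(* [M M^T = U S^2 U^T] makes column [k] of [U] an eigenvector of [M^2] for
   [s_k^2]; then [(M + s_k)(M - s_k) u_k = 0] with [M + s_k] invertible unless
   [s_k = 0], in which case [|M u_k|^2 = u_k^T M^2 u_k = 0]. *)
Lemma left_singular_eigenvectors (R : realType) (n : nat) (M U : 'M[R]_n)
    (s : 'rV[R]_n) :
  M^T = M -> sorted_eigenvalues M s -> left_singular_vectors M s U ->
  U^T *m U = 1%:M /\ M *m U = U *m diag_mx s.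
Proof.
move=> M_sym eig_s [s_ge0 [V [U_orth V_orth M_svd]]]; split=> //.
have MM_U : M *m (M *m U) = U *m diag_mx s *m diag_mx s.
  rewrite -{1}M_sym.
  have MU : M *m U = V *m diag_mx s.
    by rewrite -{1}M_sym M_svd !trmx_mul trmxK tr_diag_mx -!mulmxA U_orth mulmx1.
  by rewrite MU M_sym {1}M_svd -!mulmxA (mulmxA V^T) V_orth mul1mx.
apply/trmx_inj/row_matrixP => k; rewrite -!tr_col; congr (_^T).
have colD (A : 'M[R]_n) : col k (A *m diag_mx s) = s 0 k *: col k A.
  by apply/colP=> i; rewrite mul_mx_diag !mxE mulrC.
rewrite colD; move/(congr1 (col k)): MM_U.
rewrite !colD [col k (M *m (M *m U))]colE [col k (M *m U)]colE -!mulmxA -colE.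
set u := col k U => MMu.
have [sk0|sk_neq0] := eqVneq (s 0 k) 0.
  rewrite sk0 scale0r; apply: trmx_mul_eq0.
  by rewrite trmx_mul M_sym -mulmxA MMu sk0 scale0r mulmx0.
apply/eqP; rewrite -subr_eq0; apply/negPn/negP=> w_neq0.
(* The vector [w = M u - s_k u] is nonzero and satisfies [M w = - s_k w]. Eigenvectors in
   [eigenvalueP] are rows, so [w] is transposed, using the symmetry of [M]. *)
have : eigenvalue M (- s 0 k).
  apply/eigenvalueP; exists (M *m u - s 0 k *: u)^T; last first.
    by rewrite -(inj_eq trmx_inj) trmxK trmx0.
  apply/trmx_inj; rewrite trmx_mul [RHS]linearZ /= !trmxK M_sym.
  by rewrite mulmxBr MMu -scalemxAr scalerBr !scaleNr opprK addrC scalerA.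
(* Now [- s_k] is some [s_l], hence nonnegative; together with [0 <= s_k] this forces [s_k = 0]. *)
move=> /(sorted_eigenvalues_eigenvalue eig_s)[l sl].
move: sk_neq0; rewrite eq_le s_ge0 andbT => /negP; apply.
by rewrite -oppr_ge0 -sl s_ge0.
Qed.

(* [u^T L u] is half the sum of the nonnegative terms [W i j * (u i - u j)^2]. *)
Lemma laplacian_ker_neighbours (R : realType) (n : nat) (W : 'M[R]_n)
    (u : 'cV[R]_n) (i j : 'I_n) :
  edge_weights W -> laplacian W *m u = 0 -> neighbours W i j -> u i 0 = u j 0.
Proof.
move=> [W_sym W_ge0] Lu0 /andP[_ Wij_gt0].
have row_eq0 a : \sum_b W a b * (u a 0 - u b 0) = 0.
  have /colP/(_ a) := Lu0; rewrite mulmxBl mul_diag_mx !mxE => Lua0.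
  by rewrite -[RHS]Lua0 mulr_suml -sumrB; apply: eq_bigr => b _; rewrite mulrBr.
pose S := \sum_a \sum_b W a b * (u a 0 - u b 0) * u a 0.
have S0 : S = 0.
  by apply: big1 => a _; rewrite -mulr_suml row_eq0 mul0r.
have sqr_sum_eq0 :
    \sum_(p : 'I_n * 'I_n) W p.1 p.2 * (u p.1 0 - u p.2 0) ^+ 2 = 0.
  rewrite -(pair_bigA _ (fun a b => W a b * (u a 0 - u b 0) ^+ 2)) /=.
  (* The square splits as [(u_a - u_b) u_a + (u_b - u_a) u_b]; by symmetry of [W], the second part
     sums to [S] with the two indices exchanged. *)
  transitivity (S + S); last by rewrite S0 addr0.
  rewrite {2}/S [X in S + X]exchange_big /S.
  rewrite -big_split; apply: eq_bigr => a _ /=.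
  rewrite -big_split; apply: eq_bigr => b _ /=.
  have -> : W b a = W a b by rewrite -{1}W_sym mxE.
  by ring.
move/psumr_eq0P: sqr_sum_eq0 => /(_ _ (i, j) isT)/= Wu.
apply/eqP; rewrite -subr_eq0 -sqrf_eq0.
have /eqP := Wu (fun p _ => mulr_ge0 (W_ge0 _ _) (sqr_ge0 _)).
by rewrite mulf_eq0 gt_eqF.
Qed.

Lemma laplacian_sym (R : realType) (n : nat) (W : 'M[R]_n) :
  W^T = W -> (laplacian W)^T = laplacian W.
Proof. by move=> W_sym; rewrite /laplacian linearB /= tr_diag_mx W_sym. Qed.

Lemma laplacian_const (R : realType) (n : nat) (W : 'M[R]_n) :
  laplacian W *m const_mx 1 = 0 :> 'cV[R]_n.
Proof.
apply/colP=> i; rewrite mulmxBl mul_diag_mx !mxE mulr1.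
by under [X in _ - X]eq_bigr do rewrite mxE mulr1; rewrite subrr.
Qed.

(* Indices start at 0, so k ranging over 2, ..., n becomes 0 < k < n. *)
Theorem lemma18 (R : realType) (n : nat) (W : 'M[R]_n) (tau alpha : R)
    (s : 'rV[R]_n) (U : 'M[R]_n) (i j : 'I_n)
    (W_weights : edge_weights W) (W_connected : connected_graph W)
    (tau_gt0 : 0 < tau) (alpha_gt0 : 0 < alpha)
    (s_eigenvalues : sorted_eigenvalues (laplacian W) s)
    (U_singular : left_singular_vectors (laplacian W) s U)
    (ij_max : attains_Delta2 alpha (neighbours W)
                (expmx (- (tau *: laplacian W))) i j) :
  Delta2 alpha (neighbours W) (expmx (- (tau *: laplacian W)))
  <= alpha * \sum_(k < n | (0 < k)%N)
               expR (- (tau * s ord0 k)) * `|U i k - U j k|.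
Proof.
have L_sym := laplacian_sym W_weights.1.
have [U_orth LU] := left_singular_eigenvectors L_sym s_eigenvalues U_singular.
case: ij_max => ij ->; rewrite ler_pM2l//.
have -> : - (tau *: laplacian W) = U *m diag_mx (- tau *: s) *m U^T.
  rewrite -scaleNr linearZ /= -scalemxAr -scalemxAl -LU -mulmxA.
  by rewrite (mulmx1C U_orth) mulmx1.
rewrite expmx_orthogonal_diag//.
set A := U *m _ *m _.
pose v : 'cV[R]_n := \col_k (expR (- (tau * s 0 k)) * (U i k - U j k)).
have -> : col i A - col j A = U *m v.
  rewrite !colE -mulmxBr /A -!mulmxA; congr (_ *m _).
  rewrite mulmxBr -!colE mul_diag_mx.
  by apply/colP=> k; rewrite !mxE mulNr.
rewrite norm2_orthogonal//; apply: le_trans (norm2_le_sum v) _.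
(* The terms with [0 < k] are compared one by one; what remains is to show that the term of index 0
   vanishes. *)
rewrite (bigID (fun k : 'I_n => (0 < k)%N)) /= addrC big1 ?add0r => [|k].
  by apply: ler_sum => k _; rewrite mxE normrM ger0_norm ?expR_ge0.
rewrite -leqNgt leqn0 => /eqP k0; rewrite mxE.
have sk0 : s 0 k = 0.
  (* The constant vector, nonzero since the index [k] exists, puts 0 among the [s_l]. As [s] is
     sorted and nonnegative, its first entry is then 0. *)
  have [l sl] : exists l, s 0 l = 0.
    apply: sorted_eigenvalues_eigenvalue s_eigenvalues _.
    apply/eigenvalueP; exists (const_mx 1).
      by apply/trmx_inj; rewrite trmx_mul L_sym trmx_const laplacian_const
        scale0r trmx0.
    by apply/eqP=> /rowP/(_ k)/eqP; rewrite !mxE oner_eq0.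
  apply/eqP; rewrite eq_le U_singular.1 andbT -sl.
  by apply: s_eigenvalues.2; rewrite k0.
have /(laplacian_ker_neighbours W_weights)/(_ ij) : laplacian W *m col k U = 0.
  rewrite colE mulmxA LU -colE; apply/colP=> l.
  by rewrite mul_mx_diag !mxE sk0 mulr0.
by rewrite !mxE => ->; rewrite subrr mulr0 normr0.
Qed.
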